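(* Let $m,\lambda\in\mathbb{R}$, $T>0$ and $2\le p\le\infty$. Assume $(\psi,\phi)\in C^\infty$ is a solution to $$\partial_t\psi+\partial_x\psi=-im\phi-2i\lambda|\phi|^2\psi,\qquad \partial_t\phi-\partial_x\phi=-im\psi-2i\lambda|\psi|^2\phi,\qquad (\psi,\phi)(0)=(f,g),$$ with initial data $f,g\in C^\infty_0(\mathbb{R})$. Then there exists a decomposition $$(\psi,\phi)=(\psi_L,\phi_L)+(\psi_N,\phi_N)$$ such that $$|\psi_L(t,x)|=|f(x-t)|,\qquad |\phi_L(t,x)|=|g(x+t)|,$$ and for every $0\le t\le T$, $$\|\psi_N(t)\|_{L^p_x}+\|\phi_N(t)\|_{L^p_x}\le C\big(\|f\|_{L^2}+\|g\|_{L^2}\big),$$ where the constant $C>0$ depends only on $m$ and $T$.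
   Context: $\psi,\phi$ are complex valued functions of $(t,x)\in\mathbb{R}\times\mathbb{R}$. $C^\infty_0$ denotes smooth compactly supported (complex valued) functions. *)

(* Defs.v *)
From HB Require Import structures.
From mathcomp Require Import all_boot all_order all_algebra.
From mathcomp Require Import all_classical all_reals all_analysis.
From mathcomp Require Import complex.

Set Implicit Arguments.
Unset Strict Implicit.
Unset Printing Implicit Defensive.

Import Order.TTheory GRing.Theory Num.Theory numFieldNormedType.Exports.
Import ComplexField.Normc.
Local Open Scope classical_set_scope.
Local Open Scope ring_scope.
Local Open Scope complex_scope.

(* All directional derivatives are required, not only those along a basis: on
   the finite-dimensional spaces R and R * R used below this is the usual C^n. *)
Fixpoint Cn (R : realType) (V : normedModType R) (n : nat) (u : V -> R) : Prop :=
  if n is k.+1 then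
    continuous u /\
    forall v : V, (forall x : V, derivable u x v) /\ Cn k (fun x => 'D_v u x)
  else continuous u.

(* R[i] carries no normed space structure over R in the library, so analytic
   notions for complex valued functions are taken on real and imaginary parts. *)
Definition smoothC (R : realType) (V : normedModType R) (u : V -> R[i]) : Prop :=
  forall n : nat, Cn n (fun x => complex.Re (u x)) /\
                  Cn n (fun x => complex.Im (u x)).

Definition smooth_compact_support (R : realType) (f : R -> R[i]) : Prop :=
  smoothC f /\ compact (closure [set x : R | f x != 0]).

Definition derive1C (R : realType) (u : R -> R[i]) (x : R) : R[i] :=
  @Complex R (derive1 (fun y => complex.Re (u y)) x)
    (derive1 (fun y => complex.Im (u y)) x).

(* Points of R * R are pairs (t, x): time first. *)
Definition partial_t (R : realType) (u : R * R -> R[i]) (t x : R) : R[i] :=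
  derive1C (fun s => u (s, x)) t.

Definition partial_x (R : realType) (u : R * R -> R[i]) (t x : R) : R[i] :=
  derive1C (fun y => u (t, y)) x.

(* normc is the modulus with values in R, whereas `|z| has type R[i]. *)
Definition thirring (R : realType) (m lambda : R) (psi phi : R * R -> R[i]) : Prop :=
  forall t x : R,
    partial_t psi t x + partial_x psi t x =
      - ('i * m%:C * phi (t, x))
      - 2 * 'i * lambda%:C * (normc (phi (t, x)) ^+ 2)%:C * psi (t, x) /\
    partial_t phi t x - partial_x phi t x =
      - ('i * m%:C * psi (t, x))
      - 2 * 'i * lambda%:C * (normc (psi (t, x)) ^+ 2)%:C * phi (t, x).

Definition measurable_complex (R : realType) (u : R -> R[i]) : Prop :=
  measurable_fun [set: R] (fun x => complex.Re (u x)) /\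
  measurable_fun [set: R] (fun x => complex.Im (u x)).

Definition LpnormC (R : realType) (p : \bar R) (u : R -> R[i]) : \bar R :=
  Lnorm (@lebesgue_measure R) p (fun x : R => (normc (u x))%:E).

(* Main.v *)
(* Take psi_L := |f(x - t)| psi / |psi| and phi_L := |g(x + t)| phi / |phi|: then
   |psi_N| = ||psi| - |f(x - t)||, and neither the phase shift due to lambda nor
   finite propagation speed plays any role. With P = |psi|^2 and Q = |phi|^2, the
   equations give (P + Q)_t + (P - Q)_x = 0, hence a potential V with V_x = P + Q
   and V_t = Q - P. It grows at rate 2Q along x - t = const and decreases at rate
   2P along x + t = const. Since ||psi|'| <= |m| |phi| along x - t = const,
   Cauchy-Schwarz gives
     |psi_N(t, x)|^2 <= m^2 t / 2 (V(t, x) - V(0, x - t))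
                     <= m^2 t / 2 int_(x-t)^(x+t) (|f|^2 + |g|^2),
   and symmetrically for phi_N. This bounds the sup norm at once, the L^2 norm by
   Tonelli, and the L^p norm for 2 <= p by interpolation. *)
Require Import Defs.
From HB Require Import structures.
From mathcomp Require Import all_boot all_order all_algebra.
From mathcomp Require Import all_classical all_reals all_analysis.
From mathcomp Require Import complex.
From mathcomp Require Import measurable_realfun ess_sup_inf ring lra.

Import Order.TTheory GRing.Theory Num.Theory numFieldNormedType.Exports.
Import ComplexField.Normc.
Local Open Scope classical_set_scope.
Local Open Scope ring_scope.
Local Open Scope complex_scope.

(** * Derivatives along segments and affine paths *)

Lemma is_derive1_cvg (R : realType) (f : R -> R) (x l : R) :
  is_derive x 1 f l <-> h^-1 * (f (h + x) - f x) @[h --> 0^'] --> l.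
Proof.
have E : (fun h : R => h^-1 *: (f (h *: 1 + x) - f x)) =
         (fun h : R => h^-1 * (f (h + x) - f x)).
  by apply/funext => h; rewrite [h *: 1]mulr1.
split=> [[df dfl]|fl].
  by rewrite -dfl /derive -E; exact: df.
split; first by rewrite /derivable E; apply/cvg_ex; exists l.
by rewrite /derive E; exact: cvg_lim fl.
Qed.

(** The endpoints are unordered because the increment of a difference quotient may have either
    sign. *)
Lemma is_derive_segment_MVT (R : realType) (f df : R -> R) (a b : R) :
  (forall x, Num.min a b <= x <= Num.max a b -> is_derive x 1 f (df x)) ->
  exists2 c, Num.min a b <= c <= Num.max a b & f b - f a = df c * (b - a).
Proof.
wlog ab : a b / a <= b => [wl dfab|].
  have /orP[ab|ba] := le_total a b; first exact: wl ab dfab.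
  have [|c cab cE] := wl b a ba; first by move=> x; rewrite minC maxC; exact: dfab.
  by exists c; [rewrite minC maxC|rewrite -opprB cE; ring].
rewrite (min_idPl ab) (max_idPr ab) => dfab.
have [||c cab ->] := @MVT_segment R f df a b ab.
- by move=> x /[!in_itv]/= /andP[/ltW ax /ltW xb]; apply: dfab; rewrite ax.
- apply: derivable_within_continuous => x /[!in_itv]/= xab.
  by have [] := dfab x xab.
- by exists c => //; move: cab; rewrite in_itv.
Qed.

(** The increment splits into a move in space at the fixed time [s], handled by the one-variable
    chain rule, and a move in time at the displaced place, handled by the mean value theorem and the
    continuity of [ut]. So partial derivatives suffice, and they are all that is known of the
    potential built below. *)
Lemma is_derive_affine_path (R : realType) (u ut ux : R * R -> R) (a c s : R) :
  (\forall z \near (s, a + c * s),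
    is_derive (z.1 : R) 1 (fun r : R => u (r, z.2)) (ut z)) ->
  is_derive (a + c * s) 1 (fun y => u (s, y)) (ux (s, a + c * s)) ->
  {for (s, a + c * s), continuous ut} ->
  is_derive s 1 (fun r => u (r, a + c * r))
    (ut (s, a + c * s) + c * ux (s, a + c * s)).
Proof.
move=> dut dux cut; apply/is_derive1_cvg.
have dpath : is_derive s 1 (fun r => u (s, a + c * r)) (c * ux (s, a + c * s)).
  have dc : is_derive s 1 (fun r => a + c * r) c.
    apply: is_derive_eq; rewrite /GRing.scale/=; ring.
  have := @is_derive1_comp _ (fun y => u (s, y)) (fun r => a + c * r) s _ _ dux dc.
  by rewrite mulrC.
move/is_derive1_cvg in dpath.
set y := a + c * s in dut dux cut dpath *.
(* [D] is the time part of the difference quotient; [dpath] already gives the limit of the space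
   part. *)
pose D h := h^-1 * (u (h + s, a + c * (h + s)) - u (s, a + c * (h + s))).
suff DE : D h @[h --> 0^'] --> ut (s, y).
  apply: cvg_trans (cvgD DE dpath).
  apply: near_eq_cvg; near=> h; rewrite /D /= ?fctE; ring.
apply/cvgrPdist_le => e e0.
move/cvgrPdist_le : cut => /(_ e e0) cut.
have [d /= d0 dP] : exists2 d : R, 0 < d & forall z : R * R,
   `|s - z.1| < d -> `|y - z.2| < d ->
   is_derive (z.1 : R) 1 (fun r : R => u (r, z.2)) (ut z) /\ `|ut (s, y) - ut z| <= e.
  have /nbhs_ballP[d /= d0 dP] : \forall z \near (s, y),
      is_derive (z.1 : R) 1 (fun r : R => u (r, z.2)) (ut z) /\
      `|ut (s, y) - ut z| <= e.
    by near=> z; split; near: z.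
  by exists d => // z z1 z2; exact: dP.
(* Dividing by [|c| + 1] keeps [|c * h| < d] also when [c = 0]. *)
have d'0 : 0 < d / (`|c| + 1) by rewrite divr_gt0// ltr_wpDl.
have hd : \forall h \near 0^', `|h : R| < d by exact: dnbhs0_lt.
have hd' : \forall h \near 0^', `|h : R| < d / (`|c| + 1) by exact: dnbhs0_lt.
near=> h.
have h0 : h != 0 by near: h; exact: nbhs_dnbhs_neq.
have hltd : `|h| < d by near: h.
have hltd' : `|h| < d / (`|c| + 1) by near: h.
have yh : `|y - (a + c * (h + s))| < d.
  have -> : y - (a + c * (h + s)) = - (c * h) by rewrite /y; ring.
  rewrite normrN normrM; move: hltd'; rewrite ltr_pdivlMr; last by rewrite ltr_wpDl.
  apply: le_lt_trans; have := normr_ge0 h; have := normr_ge0 c; nra.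
have bd x : Num.min s (h + s) <= x <= Num.max s (h + s) -> `|s - x| < d.
  move=> /andP[mx xM]; apply: le_lt_trans hltd.
  rewrite ler_norml.
  have [h1|h1] := leP 0 h; move: mx xM.
    by rewrite (ger0_norm h1) ge_min le_max => /orP[] ? /orP[] ?; apply/andP; split; lra.
  by rewrite (ltr0_norm h1) ge_min le_max => /orP[] ? /orP[] ?; apply/andP; split; lra.
have [x xb|x /bd xd uE] := @is_derive_segment_MVT _ (fun r => u (r, a + c * (h + s)))
  (fun r => ut (r, a + c * (h + s))) s (h + s).
  by apply: (dP (x, _) _ _).1 => //=; exact: bd.
rewrite /D uE addrK mulrCA mulVf// mulr1.
by apply: (dP (x, _) _ _).2.
Unshelve. all: by end_near. Qed.

(** * Integrals depending on a parameter and primitives *)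

Lemma continuous_slice1 (R : realType) (u : R * R -> R) (x : R) :
  continuous u -> continuous (fun s => u (s, x)).
Proof.
by move=> cu s; exact: (cvg_comp _ _ (cvg_pair cvg_id (cvg_cst x)) (cu (s, x))).
Qed.

Lemma continuous_slice2 (R : realType) (u : R * R -> R) (t : R) :
  continuous u -> continuous (fun y => u (t, y)).
Proof.
by move=> cu y; exact: (cvg_comp _ _ (cvg_pair (cvg_cst t) cvg_id) (cu (t, y))).
Qed.

Lemma continuous_integrable_itv (R : realType) (f : R -> R) (a b : R) :
  continuous f -> (@lebesgue_measure R).-integrable `[a, b] (EFin \o f).
Proof.
move=> cf; apply: continuous_compact_integrable; first exact: segment_compact.
exact: continuous_subspaceT.
Qed.

Lemma continuous_rectangle_bounded (R : realType) (u : R * R -> R) (a b c d : R) :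
  continuous u ->
  exists2 M, 0 <= M & forall s y, s \in `[a, b] -> y \in `[c, d] ->
    `|u (s, y)| <= M.
Proof.
move=> cu.
have K : compact (`[a, b]%classic `*` `[c, d]%classic : set (R * R)).
  by apply: compact_setX; exact: segment_compact.
have /compact_bounded[M [_ MP]] : compact (u @` (`[a, b]%classic `*` `[c, d]%classic)).
  by apply: continuous_compact K; exact: continuous_subspaceT.
exists (`|M| + 1) => [|s y sab ycd]; first by rewrite addr_ge0.
apply: (MP (`|M| + 1)); first by rewrite (le_lt_trans (ler_norm M))// ltrDl.
by exists (s, y).
Qed.

(** Dominated differentiation: on the compact rectangle [[a, b]] times [[x - 1, x + 1]] the
    continuous [jx] is bounded by a constant, which is integrable over [[a, b]]. *)
Lemma is_derive_integral_param (R : realType) (j jx : R * R -> R) (a b x : R) :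
  continuous j -> continuous jx ->
  (forall s y : R, is_derive y 1 (fun y => j (s, y)) (jx (s, y))) ->
  is_derive x 1 (fun y => \int[lebesgue_measure]_(s in `[a, b]) j (s, y))
    (\int[lebesgue_measure]_(s in `[a, b]) jx (s, x)).
Proof.
move=> cj cjx dj.
have [M M0 bM] := @continuous_rectangle_bounded _ jx a b (x - 1) (x + 1) cjx.
have Ix : `]x - 1, x + 1[%classic x by rewrite /= in_itv/=; apply/andP; split; lra.
have E s y : partial1of2 (fun y s => j (s, y)) y s = jx (s, y).
  by rewrite partial1of2E; have [_] := dj s y.
have mab : measurable (`[a, b]%classic : set R) by exact: measurable_itv.
have A1 : forall y, `]x - 1, x + 1[%classic y ->
   (@lebesgue_measure R).-integrable `[a, b] (EFin \o (fun s => j (s, y))).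
  by move=> y _; apply: continuous_integrable_itv; exact: continuous_slice1.
have A2 : forall y s, `]x - 1, x + 1[%classic y -> `[a, b]%classic s ->
    derivable (fun y => j (s, y)) y 1.
  by move=> y s _ _; have [] := dj s y.
have A3 : (@lebesgue_measure R).-integrable `[a, b] (EFin \o (cst M)).
  by apply: continuous_integrable_itv => y; exact: cvg_cst.
have A4 : forall y s, `]x - 1, x + 1[%classic y -> `[a, b]%classic s ->
    `|partial1of2 (fun y s => j (s, y)) y s| <= cst M s.
  move=> y s Iy sab; rewrite E /=; apply: bM => //.
  by apply: subset_itv_oo_cc.
split.
  exact (@derivable_under_integral R _ _ (@lebesgue_measure R) (fun y s => j (s, y))
    _ mab x _ _ Ix A1 A2 (cst M) (fun=> M0) A3 A4).
rewrite -derive1E.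
rewrite (@differentiation_under_integral R _ _ (@lebesgue_measure R) (fun y s => j (s, y))
  _ mab x _ _ Ix A1 A2 (cst M) (fun=> M0) A3 A4).
by apply: eq_Rintegral => s _; rewrite E.
Qed.

(** The case [a = b] is included because the window [[x - t, x + t]] shrinks to a point at
    [t = 0]. *)
Lemma Rintegral_derive (R : realType) (f df : R -> R) (a b : R) :
  a <= b -> continuous df -> (forall x, a <= x <= b -> is_derive x 1 f (df x)) ->
  \int[lebesgue_measure]_(x in `[a, b]) df x = f b - f a.
Proof.
rewrite le_eqVlt => /predU1P[<- _ _|ab cdf dff].
  by rewrite set_itv1 Rintegral_set1 subrr.
have cf x : a <= x <= b -> {for x, continuous f}.
  move=> /dff[dfx _]; apply: differentiable_continuous.
  by rewrite -derivable1_diffP.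
have oc x : x \in `]a, b[ -> a <= x <= b by move/subset_itv_oo_cc; rewrite in_itv.
rewrite /Rintegral (@continuous_FTC2 _ df f)//.
- exact: continuous_subspaceT.
- split; first by move=> x /oc /dff[].
  + by apply: cvg_at_right_filter; apply: cf; rewrite lexx ltW.
  + by apply: cvg_at_left_filter; apply: cf; rewrite lexx ltW.
- by move=> x /oc /dff[_]; rewrite derive1E.
Qed.

Lemma is_derive_primitive (R : realType) (f : R -> R) (a x : R) :
  continuous f -> a < x ->
  is_derive x 1 (fun y => \int[lebesgue_measure]_(s in `[a, y]) f s) (f x).
Proof.
move=> cf ax.
(* Any upper end beyond [x] serves: it makes [x] interior, so the derivative is two-sided. *)
have x1 : x < x + 1 by rewrite ltrDl.
have [] := @continuous_FTC1_closed _ f a x (x + 1) x1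
  (@continuous_integrable_itv R f a _ cf) ax (cf x).
by move=> dF; rewrite derive1E => dFE; split.
Qed.

(** * Potential of a conservation law *)

(** Integrate [e] in space at time [t0], then [- j] in time at the place [x]. The time derivative is
    immediate; for the space derivative, [- jx = et] turns the differentiated flux integral into
    [e (t, x) - e (t0, x)]. The quadrant [t0 < t], [x0 < x] is where both integrals have a moving
    upper end above the base point. *)
Lemma conservation_law_potential (R : realType) (e et j jx : R * R -> R)
    (t0 x0 : R) :
  continuous e -> continuous et -> continuous j -> continuous jx ->
  (forall s y : R, is_derive s 1 (fun s => e (s, y)) (et (s, y))) ->
  (forall s y : R, is_derive y 1 (fun y => j (s, y)) (jx (s, y))) ->
  (forall z, et z + jx z = 0) ->
  exists V : R * R -> R, forall t x, t0 < t -> x0 < x ->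
    is_derive x 1 (fun y => V (t, y)) (e (t, x)) /\
    is_derive t 1 (fun s => V (s, x)) (- j (t, x)).
Proof.
move=> ce cet cj cjx de dj ej.
pose mu := @lebesgue_measure R.
exists (fun z => \int[mu]_(y in `[x0, z.2]) e (t0, y) -
                 \int[mu]_(s in `[t0, z.1]) j (s, z.2)) => t x t0t x0x /=.
have d1 := @is_derive_primitive _ (fun y => e (t0, y)) x0 x (@continuous_slice2 _ _ t0 ce) x0x.
have d2 := @is_derive_integral_param _ j jx t0 t x cj cjx dj.
have d3 := @is_derive_primitive _ (fun s => j (s, x)) t0 t (@continuous_slice1 _ _ x cj) t0t.
split.
  apply: is_derive_eq.
  have -> : \int[mu]_(s in `[t0, t]) jx (s, x) = - (e (t, x) - e (t0, x)).
    rewrite [LHS](@Rintegral_derive _ (fun s => - e (s, x)) (fun s => jx (s, x)) _ _ (ltW t0t)).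
    - ring.
    - exact: continuous_slice1.
    - move=> s _; have := de s x => des; apply: is_derive_eq.
      by have := ej (s, x); lra.
  ring.
apply: is_derive_eq; ring.
Qed.

(** * Estimates along characteristics *)

Lemma is_derive_ge0_le (R : realType) (f df : R -> R) (a b : R) : a <= b ->
  (forall x, a <= x <= b -> is_derive x 1 f (df x)) ->
  (forall x, a <= x <= b -> 0 <= df x) -> f a <= f b.
Proof.
move=> ab dff df0; rewrite -subr_ge0.
have [|c + ->] := @is_derive_segment_MVT _ f df a b.
  by rewrite (min_idPl ab) (max_idPr ab).
rewrite (min_idPl ab) (max_idPr ab) => /df0 dfc.
by rewrite mulr_ge0// subr_ge0.
Qed.

(* Minimising the right-hand side over k > 0. *)
Lemma sqr_le_of_weighted_le (R : realFieldType) (X D B : R) :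
  0 <= X -> 0 <= D -> 0 <= B ->
  (forall k, 0 < k -> X <= k * D + B / k) -> X ^+ 2 <= 4 * B * D.
Proof.
rewrite le_eqVlt => /predU1P[<- D0 B0 _|X0]; first by rewrite expr0n/= !mulr_ge0.
rewrite le_eqVlt => /predU1P[<- B0 kP|D0 B0 kP].
  (* With [D = 0] the hypothesis reads [X <= B / k], which this large [k] contradicts. *)
  have k0 : 0 < 2 * B / X + 1 by rewrite ltr_wpDl// divr_ge0 ?mulr_ge0// ltW.
  have := kP _ k0; rewrite mulr0 add0r ler_pdivlMr//.
  have -> : X * (2 * B / X + 1) = 2 * B + X by field; rewrite gt_eqF.
  lra.
(* This [k] makes [k * D] equal to [X / 2], leaving [X / 2 <= 2 * B * D / X]. *)
have k0 : 0 < X / (2 * D) by rewrite divr_gt0// mulr_gt0.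
have := kP _ k0.
have -> : X / (2 * D) * D = X / 2 by field; rewrite gt_eqF.
have -> : B / (X / (2 * D)) = 2 * B * D / X by field; rewrite !gt_eqF.
rewrite -lerBlDl ler_pdivlMr// => XX; rewrite expr2; lra.
Qed.

(** Formally the derivative of the root of [p] is at most [|m|] times the root of [q], and
    Cauchy-Schwarz in time concludes. Instead of integrating, the pointwise weighted inequality with
    parameter [k] is propagated by monotonicity, and [k] is optimised at the end. *)
Lemma sqrt_transport_bound (R : realType) (p dp q v : R -> R) (m t : R) :
  0 <= t -> (forall s, 0 <= p s) -> (forall s, 0 <= q s) ->
  (forall s, 0 <= s <= t -> is_derive s 1 p (dp s)) ->
  (forall s, 0 <= s <= t -> is_derive s 1 v (2 * q s)) ->
  (forall s, `|dp s| <= 2 * `|m| * Num.sqrt (p s) * Num.sqrt (q s)) ->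
  (Num.sqrt (p t) - Num.sqrt (p 0)) ^+ 2 <= m ^+ 2 * t / 2 * (v t - v 0).
Proof.
move=> t0 p0 q0 dpp dv pq.
have D0 : 0 <= v t - v 0.
  rewrite subr_ge0; apply: (is_derive_ge0_le _ _ _ _ _ t0 dv) => s _.
  by rewrite mulr_ge0.
suff Xk k : 0 < k -> `|Num.sqrt (p t) - Num.sqrt (p 0)| <=
    k * (v t - v 0) + m ^+ 2 * t / 8 / k.
  (* Here [B] is [m ^+ 2 * t / 8], so the factor [4 * B] is the announced [m ^+ 2 * t / 2]. *)
  have := sqr_le_of_weighted_le _ _ _ _ (normr_ge0 _) D0 _ Xk.
  rewrite real_normK ?num_real// => /(_ _)/le_trans; apply; last by lra.
  by rewrite divr_ge0// mulr_ge0// sqr_ge0.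
move=> k0; apply/ler_addgt0Pr => e e0.
(* The square root is not differentiable where [p] vanishes. The regularised root [w] is, and it
   exceeds the true one by at most [e / 2]. *)
pose w s := Num.sqrt (p s + (e / 2) ^+ 2).
have e20 : 0 < (e / 2) ^+ 2 by rewrite exprn_gt0// divr_gt0.
have pw s : 0 < p s + (e / 2) ^+ 2 by rewrite ltr_wpDl.
have w0 s : 0 < w s by rewrite sqrtr_gt0.
have sw s : Num.sqrt (p s) <= w s by apply: ler_wsqrtr; rewrite lerDl ltW.
have ws s : w s <= Num.sqrt (p s) + e / 2.
  rewrite -(@ler_pXn2r _ 2) ?nnegrE ?addr_ge0 ?sqrtr_ge0 ?divr_ge0 ?(ltW e0)//.
  rewrite sqr_sqrtr ?(ltW (pw s))// sqrrD sqr_sqrtr//.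
  by rewrite lerD2r lerDl mulrn_wge0// mulr_ge0 ?sqrtr_ge0// divr_ge0// ltW.
have dw s : 0 <= s <= t -> is_derive s 1 w ((2 * w s)^-1 * dp s).
  move=> /dpp dps.
  have dp2 : is_derive s 1 (fun s => p s + (e / 2) ^+ 2) (dp s).
    by apply: is_derive_eq; rewrite addr0.
  exact: (@is_derive1_comp _ Num.sqrt (fun s => p s + (e / 2) ^+ 2) s _ _
    (is_derive1_sqrt (pw s)) dp2).
(* Completing the square: [2 k a^2 + m^2 / (8 k) - |m| a] is [2 k (a - |m| / (4 k))^2]. *)
have dwb s : `|(2 * w s)^-1 * dp s| <= k * (2 * q s) + m ^+ 2 / 8 / k.
  rewrite normrM ger0_norm ?invr_ge0 ?mulr_ge0 ?(ltW (w0 s))// mulrC.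
  rewrite ler_pdivrMr ?mulr_gt0//; apply: le_trans (pq s) _.
  have H : `|m| * Num.sqrt (q s) <= k * (2 * q s) + m ^+ 2 / 8 / k.
    rewrite -subr_ge0 -{1}(sqr_sqrtr (q0 s)) -[m ^+ 2]real_normK ?num_real//.
    set a := Num.sqrt (q s).
    have -> : k * (2 * a ^+ 2) + `|m| ^+ 2 / 8 / k - `|m| * a =
      2 * k * (a - `|m| / (4 * k)) ^+ 2 by field; rewrite gt_eqF.
    by rewrite mulr_ge0 ?sqr_ge0// mulr_ge0// ltW.
  apply: (@le_trans _ _ (2 * w s * (`|m| * Num.sqrt (q s)))).
    rewrite [leLHS](_ : _ = 2 * (`|m| * Num.sqrt (q s)) * Num.sqrt (p s)); last by ring.
    rewrite [leRHS](_ : _ = 2 * (`|m| * Num.sqrt (q s)) * w s); last by ring.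
    by rewrite ler_wpM2l// mulr_ge0// mulr_ge0 ?normr_ge0 ?sqrtr_ge0.
  by rewrite mulrC ler_wpM2r// mulr_ge0// ltW.
(* The bound on the derivative of [w] makes [k * v + m ^+ 2 / 8 / k * s - b * w] nondecreasing; the
   signs [b = 1] and [b = -1] together give the absolute value. *)
have W b : `|b| = 1 -> b * (w t - w 0) <= k * (v t - v 0) + m ^+ 2 * t / 8 / k.
  move=> b1; rewrite -subr_ge0.
  have dg s : 0 <= s <= t -> is_derive s 1
      (fun s => k * v s + m ^+ 2 / 8 / k * s - b * w s)
      (k * (2 * q s) + m ^+ 2 / 8 / k - b * ((2 * w s)^-1 * dp s)).
    move=> s0t; have := dw s s0t; have := dv s s0t => dvs dws.
    by apply: is_derive_eq; rewrite /GRing.scale/=; ring.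
  have := is_derive_ge0_le _ _ _ _ _ t0 dg; rewrite /= -subr_ge0.
  move=> H; apply: le_trans (H _) _; last first.
    by rewrite le_eqVlt; apply/orP; left; apply/eqP; field; rewrite gt_eqF.
  move=> s _; rewrite subr_ge0; apply: le_trans (dwb s).
  by apply: le_trans (ler_norm _) _; rewrite normrM b1 mul1r.
have := W 1 (normr1 _); have := W (-1) (normrN1 _).
have := sw t; have := sw 0; have := ws t; have := ws 0 => *.
rewrite ler_norml; apply/andP; split; lra.
Qed.

Lemma near_gt_pair (R : realType) (a b : R) (z : R * R) : a < z.1 -> b < z.2 ->
  \forall y \near z, a < y.1 /\ b < y.2.
Proof.
move=> az bz; near=> y; split; near: y.
- by apply: (cvgr_gt z.1) => //; exact: cvg_fst.
- by apply: (cvgr_gt z.2) => //; exact: cvg_snd.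
Unshelve. all: by end_near. Qed.

(** The exchange term [g] cancels in the sum of the two transport equations, which provides the
    potential [V]. Its increments along the two characteristics through [(t, x)] control the roots
    of [P] and [Q], and each increment is at most the difference of [V] between the two feet [x - t]
    and [x + t]. *)
Lemma characteristic_bounds (R : realType) (m : R)
    (P Pt Px Q Qt Qx g : R * R -> R) (t x : R) :
  continuous P -> continuous Pt -> continuous Px ->
  continuous Q -> continuous Qt -> continuous Qx ->
  (forall s y : R, is_derive s 1 (fun s => P (s, y)) (Pt (s, y))) ->
  (forall s y : R, is_derive y 1 (fun y => P (s, y)) (Px (s, y))) ->
  (forall s y : R, is_derive s 1 (fun s => Q (s, y)) (Qt (s, y))) ->
  (forall s y : R, is_derive y 1 (fun y => Q (s, y)) (Qx (s, y))) ->
  (forall z, 0 <= P z) -> (forall z, 0 <= Q z) ->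
  (forall z, Pt z + Px z = g z) -> (forall z, Qt z - Qx z = - g z) ->
  (forall z, `|g z| <= 2 * `|m| * Num.sqrt (P z) * Num.sqrt (Q z)) ->
  0 <= t ->
  let B := m ^+ 2 * t / 2 *
    \int[lebesgue_measure]_(y in `[x - t, x + t]) (P (0, y) + Q (0, y)) in
  (Num.sqrt (P (t, x)) - Num.sqrt (P (0, x - t))) ^+ 2 <= B /\
  (Num.sqrt (Q (t, x)) - Num.sqrt (Q (0, x + t))) ^+ 2 <= B.
Proof.
move=> cP cPt cPx cQ cQt cQx dPt dPx dQt dQx P0 Q0 Pg Qg gb t0 B.
have ce : continuous (fun z => P z + Q z) by move=> z; apply: cvgD; [exact: cP|exact: cQ].
have cj : continuous (fun z => P z - Q z) by move=> z; apply: cvgB; [exact: cP|exact: cQ].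
have cet : continuous (fun z => Pt z + Qt z) by move=> z; apply: cvgD; [exact: cPt|exact: cQt].
have cjx : continuous (fun z => Px z - Qx z) by move=> z; apply: cvgB; [exact: cPx|exact: cQx].
have de (s y : R) : is_derive s 1 (fun s => P (s, y) + Q (s, y)) (Pt (s, y) + Qt (s, y)).
  by have := dPt s y; have := dQt s y => ? ?; apply: is_derive_eq.
have dj (s y : R) : is_derive y 1 (fun y => P (s, y) - Q (s, y)) (Px (s, y) - Qx (s, y)).
  by have := dPx s y; have := dQx s y => ? ?; apply: is_derive_eq.
(* The base point lies outside the backward triangle with apex (t, x), so that V
   is differentiable on all of it. *)
have [V VP] := @conservation_law_potential R _ _ _ _ (- 1) (x - t - 1) ce cet cj cjx de dj
  (fun z => ltac:(have := Pg z; have := Qg z; lra)).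
(* Stated for functions differentiable on the quadrant only, so that it serves [V] as well as [P]
   and [Q]. *)
have path (u ut ux : R * R -> R) a c s : - 1 < s -> x - t - 1 < a + c * s -> continuous ut ->
    (forall s y, - 1 < s -> x - t - 1 < y -> is_derive y 1 (fun y => u (s, y)) (ux (s, y)) /\
      is_derive s 1 (fun s => u (s, y)) (ut (s, y))) ->
    is_derive s 1 (fun r => u (r, a + c * r)) (ut (s, a + c * s) + c * ux (s, a + c * s)).
  move=> s1 xs cut du; apply: (is_derive_affine_path _ _ _ ux); last exact: cut.
    have := near_gt_pair _ (-1) (x - t - 1) (s, a + c * s) s1 xs.
    by apply: filterS => -[r y] /= [r1 xy]; exact: (du r y r1 xy).2.
  exact: (du _ _ s1 xs).1.
have cNj : continuous (fun z => - (P z - Q z)) by move=> z; apply: cvgN; exact: cj.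
have pathV a c s s1 xs := path V (fun z => - (P z - Q z)) (fun z => P z + Q z) a c s s1 xs cNj VP.
have right s : 0 <= s <= t -> - 1 < s /\ x - t - 1 < x - t + 1 * s.
  by move=> /andP[? ?]; split; lra.
have left s : 0 <= s <= t -> - 1 < s /\ x - t - 1 < x + t + (- 1) * s.
  by move=> /andP[? ?]; split; lra.
have dVr s : 0 <= s <= t ->
    is_derive s 1 (fun r => V (r, x - t + 1 * r)) (2 * Q (s, x - t + 1 * s)).
  move=> /right[s1 xs]; have := pathV _ _ _ s1 xs => D.
  by apply: is_derive_eq; ring.
have dVl s : 0 <= s <= t ->
    is_derive s 1 (fun r => - V (r, x + t + (- 1) * r)) (2 * P (s, x + t + (- 1) * s)).
  move=> /left[s1 xs]; have := pathV _ _ _ s1 xs => D.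
  by apply: is_derive_eq; ring.
have dPr s : 0 <= s <= t ->
    is_derive s 1 (fun r => P (r, x - t + 1 * r)) (g (s, x - t + 1 * s)).
  move=> /right[s1 xs].
  have := path P Pt Px _ _ _ s1 xs cPt (fun s y _ _ => conj (dPx s y) (dPt s y)) => D.
  by apply: is_derive_eq; rewrite -Pg; ring.
have dQl s : 0 <= s <= t ->
    is_derive s 1 (fun r => Q (r, x + t + (- 1) * r)) (- g (s, x + t + (- 1) * s)).
  move=> /left[s1 xs].
  have := path Q Qt Qx _ _ _ s1 xs cQt (fun s y _ _ => conj (dQx s y) (dQt s y)) => D.
  by apply: is_derive_eq; rewrite -Qg; ring.
have e1 : x - t + 1 * t = x by ring.
have e2 : x - t + 1 * 0 = x - t by ring.
have e3 : x + t + (- 1) * t = x by ring.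
have e4 : x + t + (- 1) * 0 = x + t by ring.
(* The value of [V] at the apex lies between its values at the two feet, so either increment is
   bounded by their difference. *)
have V1 : V (0, x - t) <= V (t, x).
  have := is_derive_ge0_le _ _ _ _ _ t0 dVr; rewrite /= e1 e2; apply => s _.
  by rewrite mulr_ge0.
have V2 : V (t, x) <= V (0, x + t).
  have := is_derive_ge0_le _ _ _ _ _ t0 dVl; rewrite /= e3 e4 lerN2; apply => s _.
  by rewrite mulr_ge0.
have BE : B = m ^+ 2 * t / 2 * (V (0, x + t) - V (0, x - t)).
  rewrite /B; congr (_ * _).
  rewrite [LHS](@Rintegral_derive _ (fun y => V (0, y)) (fun y => P (0, y) + Q (0, y)))//.
  - by lra.
  - exact: (@continuous_slice2 _ (fun z => P z + Q z)).
  - by move=> y /andP[y1 y2]; apply: (VP _ _ _ _).1; lra.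
have mt : 0 <= m ^+ 2 * t / 2 by rewrite divr_ge0// mulr_ge0// sqr_ge0.
split.
- have := sqrt_transport_bound _ _ _ _ _ m _ t0 (fun s => P0 _) (fun s => Q0 _)
    dPr dVr (fun s => gb _).
  rewrite /= e1 e2 BE => /le_trans; apply; apply: ler_wpM2l => //; lra.
- have := sqrt_transport_bound _ _ _ _ _ m _ t0 (fun s => Q0 _) (fun s => P0 _) dQl dVl.
  rewrite /= e3 e4 BE => /(_ _)/le_trans; apply; last by apply: ler_wpM2l => //; lra.
  by move=> s; rewrite normrN (le_trans (gb _))// le_eqVlt; apply/orP; left; apply/eqP; ring.
Qed.

(** * From pointwise window bounds to Lebesgue norms *)

(** Interpolation: for finite [p], [h ^ p] is at most [M ^ (p - 2)] times [h ^ 2]. As one [M] bounds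
    both the sup norm and the L^2 norm, it bounds every norm in between. *)
Lemma Lnorm_le_bound (R : realType) (h : R -> R) (M : R) (p : \bar R) :
  measurable_fun [set: R] h -> (forall x, 0 <= h x <= M) ->
  (\int[lebesgue_measure]_x (h x ^+ 2)%:E <= (M ^+ 2)%:E)%E -> (2%:E <= p)%E ->
  (Lnorm (@lebesgue_measure R) p (fun x => (h x)%:E) <= M%:E)%E.
Proof.
move=> mh h0M hM.
have h0 x : 0 <= h x by case/andP: (h0M x).
have hleM x : h x <= M by case/andP: (h0M x).
have M0 : 0 <= M := le_trans (h0 0) (hleM 0).
rewrite unlock; case: p => [p|_|//]; last first.
  case: ifPn => _; last by rewrite lee_fin.
  by apply/ess_supP; apply: nearW => x /=; rewrite lee_fin ger0_norm.
rewrite lee_fin => p2.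
have p0 : 0 < p by rewrite (lt_le_trans _ p2).
have powM x : 0 <= x -> x `^ p = x `^ (p - 2) * x ^+ 2.
  move=> x0; rewrite -(powR_mulrn _ x0) -powRD ?subrK//.
  by rewrite gt_eqF.
have I : (\int[lebesgue_measure]_x `|(h x)%:E| `^ p <= (M `^ p)%:E)%E.
  apply: (@le_trans _ _ (\int[lebesgue_measure]_x ((M `^ (p - 2))%:E * (h x ^+ 2)%:E))%E).
    apply: ge0_le_integral => //.
    - by move=> x _; rewrite poweR_ge0.
    - under eq_fun do rewrite abse_EFin poweR_EFin.
      apply/measurable_EFinP; apply: (measurableT_comp (measurable_powR p)).
      exact: measurableT_comp.
    - by apply: measurable_funeM; apply/measurable_EFinP; exact: measurable_funX.
    - move=> x _; rewrite abse_EFin poweR_EFin -EFinM lee_fin ger0_norm// powM//.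
      by rewrite ler_wpM2r ?sqr_ge0// ge0_ler_powR ?nnegrE// subr_ge0.
  rewrite ge0_integralZl_EFin//.
  - by rewrite powM// EFinM lee_wpmul2l// lee_fin powR_ge0.
  - by move=> x _; rewrite lee_fin sqr_ge0.
  - by apply/measurable_EFinP; exact: measurable_funX.
  - exact: powR_ge0.
have -> : M%:E = ((M `^ p)%:E `^ p^-1)%E.
  by rewrite poweR_EFin -powRrM divff ?gt_eqF// powRr1.
apply: gt0_ler_poweR => //.
- by rewrite invr_ge0 ltW.
- by rewrite in_itv/= leey andbT; apply: integral_ge0 => x _; rewrite lee_fin powR_ge0.
- by rewrite in_itv/= leey andbT lee_fin powR_ge0.
Qed.

(** Tonelli on the strip [D]: [y] lies in the window around [x] exactly when [x] lies in the window
    around [y], so each [y] is counted with weight [2 * r]. *)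
Lemma integral_moving_window (R : realType) (f : R -> R) (r : R) :
  0 <= r -> measurable_fun [set: R] f -> (forall y, 0 <= f y) ->
  let W x := (\int[lebesgue_measure]_(y in `[(x - r)%R, (x + r)%R]) (f y)%:E)%E in
  measurable_fun [set: R] W /\
  (\int[lebesgue_measure]_x W x =
    (2 * r)%:E * \int[lebesgue_measure]_y (f y)%:E)%E.
Proof.
move=> r0 mf f0 W.
pose D := [set z : measurableTypeR R * measurableTypeR R | z.2 - z.1 \in `[- r, r]].
pose F := (fun z : measurableTypeR R * measurableTypeR R => (f z.2)%:E) \_ D.
have mD : measurable D.
  have mB : measurable_fun [set: measurableTypeR R * measurableTypeR R] (fun z => z.2 - z.1 : R).
    by apply: measurable_funB; [exact: measurable_snd|exact: measurable_fst].
  have := mB measurableT _ (measurable_itv `[- r, r]).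
  by rewrite setTI.
have mF : measurable_fun setT F.
  apply/(measurable_restrictT _ mD); apply: measurable_funTS.
  by apply/measurable_EFinP; exact: (measurableT_comp mf measurable_snd).
have F0 z : (0 <= F z)%E by apply: erestrict_ge0 => y _; rewrite lee_fin.
have F1 : W = (fun x => \int[lebesgue_measure]_y F (x, y))%E.
  apply/funext => x; rewrite /W integral_mkcond; apply: eq_integral => y _.
  rewrite /F /patch; congr (if _ then _ else _).
  apply/idP/idP; rewrite !inE /D /= !in_itv/= => /andP[? ?]; apply/andP; split; lra.
have F2 y : (\int[lebesgue_measure]_x F (x, y) = (2 * r)%:E * (f y)%:E)%E.
  transitivity (\int[lebesgue_measure]_(x in `[(y - r)%R, (y + r)%R]) (cst (f y)%:E x))%E.
    rewrite [RHS]integral_mkcond; apply: eq_integral => x _.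
    rewrite /F /patch; congr (if _ then _ else _).
    apply/idP/idP; rewrite !inE /D /= !in_itv/= => /andP[? ?]; apply/andP; split; lra.
  rewrite integral_cst//= lebesgue_measure_itv/= lte_fin.
  have [yr|ry] := ltP.
    by rewrite -EFinB -!EFinM; congr EFin; ring.
  (* A degenerate window has [r = 0], and both sides vanish. *)
  have -> : r = 0 by lra.
  by rewrite mule0 mulr0 mul0e.
rewrite F1; split; first exact: (measurable_fun_fubini_tonelli_F F mF F0).
rewrite (@fubini_tonelli _ _ _ _ _ _ _ F mF F0).
under eq_integral do rewrite F2.
rewrite ge0_integralZl_EFin//.
- by move=> y _; rewrite lee_fin.
- exact/measurable_EFinP.
- by rewrite mulr_ge0.
Qed.

(** A window integral is at most [E], so [A <= K ^+ 2] gives the sup bound; integrating it over all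
    windows costs [2 * r], so [A * (2 * r) <= K ^+ 2] gives the L^2 bound. *)
Lemma window_Lnorm_bound (R : realType) (h e0 : R -> R) (E r A K : R) (p : \bar R) :
  measurable_fun [set: R] h -> (forall x, 0 <= h x) ->
  continuous e0 -> (forall x, 0 <= e0 x) ->
  (\int[lebesgue_measure]_x (e0 x)%:E = E%:E)%E ->
  0 <= r -> 0 <= A -> 0 <= K -> A <= K ^+ 2 -> A * (2 * r) <= K ^+ 2 ->
  (forall x, h x ^+ 2 <=
     A * \int[lebesgue_measure]_(y in `[x - r, x + r]) e0 y) ->
  (2%:E <= p)%E ->
  (Lnorm (@lebesgue_measure R) p (fun x => (h x)%:E) <= (K * Num.sqrt E)%:E)%E.
Proof.
move=> mh h0 ce e00 IE r0 A0 K0 AK ArK hA p2.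
pose mu := @lebesgue_measure R.
have me : measurable_fun [set: R] e0 by exact: continuous_measurable_fun.
have E0 : 0 <= E.
  by rewrite -lee_fin -IE; apply: integral_ge0 => x _; rewrite lee_fin.
pose w x := \int[mu]_(y in `[x - r, x + r]) e0 y.
have wE x : ((w x)%:E = \int[mu]_(y in `[(x - r)%R, (x + r)%R]) (e0 y)%:E)%E.
  rewrite /w /Rintegral fineK//.
  exact: (integrable_fin_num _ (continuous_integrable_itv _ _ _ _ ce)).
have wleE x : w x <= E.
  rewrite -lee_fin wE -IE; apply: ge0_subset_integral => //.
  - exact/measurable_EFinP.
  - by move=> y _; rewrite lee_fin.
have KE : (K * Num.sqrt E) ^+ 2 = K ^+ 2 * E by rewrite exprMn sqr_sqrtr.
apply: Lnorm_le_bound => //.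
- move=> x; rewrite h0/= -(@ler_pXn2r _ 2)// ?nnegrE ?mulr_ge0 ?sqrtr_ge0//.
  rewrite KE (le_trans (hA x))//.
  by apply: le_trans (ler_wpM2l A0 (wleE x)) _; rewrite ler_wpM2r.
- have [mW IW] := integral_moving_window _ _ _ r0 me e00.
  have hW x : ((h x ^+ 2)%:E <= A%:E *
      \int[mu]_(y in `[(x - r)%R, (x + r)%R]) (e0 y)%:E)%E.
    by rewrite -wE -EFinM lee_fin.
  have W0 x : (0 <= \int[mu]_(y in `[(x - r)%R, (x + r)%R]) (e0 y)%:E)%E.
    by apply: integral_ge0 => y _; rewrite lee_fin.
  apply: (@le_trans _ _ (\int[mu]_x (A%:E *
      \int[mu]_(y in `[(x - r)%R, (x + r)%R]) (e0 y)%:E))%E).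
    apply: ge0_le_integral => //.
    - by move=> x _; rewrite lee_fin sqr_ge0.
    - by apply/measurable_EFinP; exact: measurable_funX.
    - exact: measurable_funeM.
  rewrite ge0_integralZl_EFin// IW IE KE -!EFinM lee_fin mulrA.
  by rewrite ler_wpM2r.
Qed.

(** * The Thirring system in real form and its densities *)

Lemma Cn1_is_derive1 (R : realType) (u : R * R -> R) : Cn 1 u ->
  forall s y : R, is_derive s 1 (fun s => u (s, y)) ('D_(1, 0) u (s, y)).
Proof.
move=> [_ /(_ (1, 0))[du _]] s y.
have E : (fun h : R => h^-1 *: (u (h *: (1, 0) + (s, y)) - u (s, y))) =
  (fun h : R => h^-1 *: (u (h *: 1 + s, y) - u (s, y))).
  apply/funext => h; congr (_ *: (u _ - _)).
  by rewrite /= ; congr pair; rewrite /= ?scaler0 ?add0r.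
split; first by have := du (s, y); rewrite /derivable E.
by rewrite /derive E.
Qed.

Lemma Cn1_is_derive2 (R : realType) (u : R * R -> R) : Cn 1 u ->
  forall s y : R, is_derive y 1 (fun y => u (s, y)) ('D_(0, 1) u (s, y)).
Proof.
move=> [_ /(_ (0, 1))[du _]] s y.
have E : (fun h : R => h^-1 *: (u (h *: (0, 1) + (s, y)) - u (s, y))) =
  (fun h : R => h^-1 *: (u (s, h *: 1 + y) - u (s, y))).
  apply/funext => h; congr (_ *: (u _ - _)).
  by rewrite /= ; congr pair; rewrite /= ?scaler0 ?add0r.
split; first by have := du (s, y); rewrite /derivable E.
by rewrite /derive E.
Qed.

(** Directional derivatives on the plane replace derivatives of slices, since [smoothC] makes them
    jointly continuous. *)
Lemma thirring_ReIm (R : realType) (m lambda : R) (psi phi : R * R -> R[i])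
    (z : R * R) :
  smoothC psi -> smoothC phi -> thirring m lambda psi phi ->
  let a := complex.Re (psi z) in let b := complex.Im (psi z) in
  let c := complex.Re (phi z) in let d := complex.Im (phi z) in
  let dt u := 'D_(1, 0) u z in let dx u := 'D_(0, 1) u z in
  [/\ dt (fun z => complex.Re (psi z)) + dx (fun z => complex.Re (psi z)) =
        m * d + 2 * lambda * (c ^+ 2 + d ^+ 2) * b,
      dt (fun z => complex.Im (psi z)) + dx (fun z => complex.Im (psi z)) =
        - (m * c) - 2 * lambda * (c ^+ 2 + d ^+ 2) * a,
      dt (fun z => complex.Re (phi z)) - dx (fun z => complex.Re (phi z)) =
        m * b + 2 * lambda * (a ^+ 2 + b ^+ 2) * d &
      dt (fun z => complex.Im (phi z)) - dx (fun z => complex.Im (phi z)) =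
        - (m * a) - 2 * lambda * (a ^+ 2 + b ^+ 2) * c].
Proof.
case: z => t x spsi sphi /(_ t x).
have [ra rb] := spsi 1%N; have [rc rd] := sphi 1%N.
have [_ ta] := Cn1_is_derive1 _ _ ra t x; have [_ xa] := Cn1_is_derive2 _ _ ra t x.
have [_ tb] := Cn1_is_derive1 _ _ rb t x; have [_ xb] := Cn1_is_derive2 _ _ rb t x.
have [_ tc] := Cn1_is_derive1 _ _ rc t x; have [_ xc] := Cn1_is_derive2 _ _ rc t x.
have [_ td] := Cn1_is_derive1 _ _ rd t x; have [_ xd] := Cn1_is_derive2 _ _ rd t x.
rewrite /partial_t /partial_x /derive1C !derive1E ta xa tb xb tc xc td xd.
case: (psi (t, x)) => a b; case: (phi (t, x)) => c d.
rewrite /= !sqr_sqrtr ?addr_ge0 ?sqr_ge0//.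
move=> [/eqP + /eqP]; rewrite !eq_complex/= => /andP[/eqP e1 /eqP e2] /andP[/eqP e3 /eqP e4].
split; [rewrite e1|rewrite e2|rewrite e3|rewrite e4]; ring.
Qed.

Lemma normc_sqrtE (R : rcfType) (z : R[i]) :
  normc z = Num.sqrt (complex.Re z ^+ 2 + complex.Im z ^+ 2).
Proof. by case: z. Qed.

Lemma normc_ge0 (R : rcfType) (z : R[i]) : 0 <= normc z.
Proof. by rewrite normc_sqrtE sqrtr_ge0. Qed.

Lemma sqr_normcE (R : rcfType) (z : R[i]) :
  normc z ^+ 2 = complex.Re z ^+ 2 + complex.Im z ^+ 2.
Proof. by rewrite normc_sqrtE sqr_sqrtr// addr_ge0 ?sqr_ge0. Qed.

Lemma normc_real (R : rcfType) (r : R) : normc r%:C = `|r|.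
Proof. by rewrite normc_sqrtE /= expr0n/= addr0 sqrtr_sqr. Qed.

(** In the equations for the squared moduli the cubic terms cancel, being real multiples of
    [i * psi] and [i * phi]. Only the mass term survives: [g] is [2 * m] times the imaginary part of
    the conjugate of [psi] times [phi]. *)
Lemma thirring_characteristic_bounds (R : realType) (m lambda : R)
    (psi phi : R * R -> R[i]) (t x : R) :
  smoothC psi -> smoothC phi -> thirring m lambda psi phi -> 0 <= t ->
  let B := m ^+ 2 * t / 2 * \int[lebesgue_measure]_(y in `[x - t, x + t])
    (normc (psi (0, y)) ^+ 2 + normc (phi (0, y)) ^+ 2) in
  (normc (psi (t, x)) - normc (psi (0, x - t))) ^+ 2 <= B /\
  (normc (phi (t, x)) - normc (phi (0, x + t))) ^+ 2 <= B.
Proof.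
move=> spsi sphi eqn t0.
pose a z := complex.Re (psi z); pose b z := complex.Im (psi z).
pose c z := complex.Re (phi z); pose d z := complex.Im (phi z).
have [ra rb] : Cn 1 a /\ Cn 1 b := spsi 1%N.
have [rc rd] : Cn 1 c /\ Cn 1 d := sphi 1%N.
pose sq (u v : R * R -> R) z := u z ^+ 2 + v z ^+ 2.
pose dsq (w : R * R) (u v : R * R -> R) z := 2 * (u z * 'D_w u z + v z * 'D_w v z).
have csq u v : Cn 1 u -> Cn 1 v -> continuous (sq u v).
  by move=> [cu _] [cv _] z; apply: cvgD; [exact: (cvgM (cu z) (cu z))|exact: (cvgM (cv z) (cv z))].
have cdsq w u v : Cn 1 u -> Cn 1 v -> continuous (dsq w u v).
  move=> [cu /(_ w)[_ cdu]] [cv /(_ w)[_ cdv]] z.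
  by apply: cvgM; [exact: cvg_cst|apply: cvgD; apply: cvgM;
    [exact: cu|exact: cdu|exact: cv|exact: cdv]].
have dsq1 u v : Cn 1 u -> Cn 1 v -> forall s y : R,
    is_derive s 1 (fun s => sq u v (s, y)) (dsq (1, 0) u v (s, y)).
  move=> ru rv s y; have := Cn1_is_derive1 _ _ ru s y; have := Cn1_is_derive1 _ _ rv s y => dv du.
  by rewrite /sq; apply: is_derive_eq; rewrite /dsq /GRing.scale/=; ring.
have dsq2 u v : Cn 1 u -> Cn 1 v -> forall s y : R,
    is_derive y 1 (fun y => sq u v (s, y)) (dsq (0, 1) u v (s, y)).
  move=> ru rv s y; have := Cn1_is_derive2 _ _ ru s y; have := Cn1_is_derive2 _ _ rv s y => dv du.
  by rewrite /sq; apply: is_derive_eq; rewrite /dsq /GRing.scale/=; ring.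
have sq0 u v z : 0 <= sq u v z by rewrite addr_ge0 ?sqr_ge0.
have E z := thirring_ReIm _ _ _ _ _ z spsi sphi eqn.
pose g z := 2 * m * (a z * d z - b z * c z).
have Pg z : dsq (1, 0) a b z + dsq (0, 1) a b z = g z.
  have [Ea Eb _ _] := E z; rewrite /dsq /g.
  transitivity (2 * (a z * ('D_(1, 0) a z + 'D_(0, 1) a z) +
    b z * ('D_(1, 0) b z + 'D_(0, 1) b z))).
    by ring.
  by rewrite Ea Eb -/(a z) -/(b z) -/(c z) -/(d z); ring.
have Qg z : dsq (1, 0) c d z - dsq (0, 1) c d z = - g z.
  have [_ _ Ec Ed] := E z; rewrite /dsq /g.
  transitivity (2 * (c z * ('D_(1, 0) c z - 'D_(0, 1) c z) +
    d z * ('D_(1, 0) d z - 'D_(0, 1) d z))).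
    by ring.
  by rewrite Ec Ed -/(a z) -/(b z) -/(c z) -/(d z); ring.
have gb z : `|g z| <= 2 * `|m| * Num.sqrt (sq a b z) * Num.sqrt (sq c d z).
  rewrite -mulrA -sqrtrM// /g normrM normrM (ger0_norm (ler0n _ 2)) ler_wpM2l ?mulr_ge0//.
  rewrite -sqrtr_sqr; apply: ler_wsqrtr; rewrite /sq.
  (* Lagrange's identity: the squares of [a d - b c] and [a c + b d] add up to
     [(a^2 + b^2) (c^2 + d^2)]. *)
  by have := sqr_ge0 (a z * c z + b z * d z); lra.
have [] := characteristic_bounds _ m _ _ _ _ _ _ g t x
  (csq _ _ ra rb) (cdsq _ _ _ ra rb) (cdsq _ _ _ ra rb)
  (csq _ _ rc rd) (cdsq _ _ _ rc rd) (cdsq _ _ _ rc rd)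
  (dsq1 _ _ ra rb) (dsq2 _ _ ra rb) (dsq1 _ _ rc rd) (dsq2 _ _ rc rd)
  (sq0 _ _) (sq0 _ _) Pg Qg gb t0.
rewrite !normc_sqrtE => B1 B2 B.
have -> : B = m ^+ 2 * t / 2 *
  \int[lebesgue_measure]_(y in `[x - t, x + t]) (sq a b (0, y) + sq c d (0, y)).
  by rewrite /B; congr (_ * _); apply: eq_Rintegral => y _; rewrite !sqr_normcE.
by [].
Qed.

(** * Unit phases, moduli and measurability *)

(** The value 1 at zero keeps the modulus equal to 1 everywhere, so the linear parts have the
    prescribed modulus even where the solution vanishes. *)
Definition unit_phase {R : rcfType} (u : R[i]) : R[i] :=
  if u == 0 then 1 else (normc u)^-1%:C * u.

Lemma normc_unit_phase (R : rcfType) (u : R[i]) : normc (unit_phase u) = 1.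
Proof.
rewrite /unit_phase; case: eqVneq => [_|u0]; first exact: normc1.
have nu0 : normc u != 0 by apply: contra u0 => /eqP/eq0_normc ->.
by rewrite normcM normc_real ger0_norm ?invr_ge0 ?normc_ge0// mulVf.
Qed.

Lemma normc_mul_unit_phase (R : rcfType) (u : R[i]) :
  u = (normc u)%:C * unit_phase u.
Proof.
rewrite /unit_phase; case: eqVneq => [->|u0]; first by rewrite normc0 mul0r.
have nu0 : normc u != 0 by apply: contra u0 => /eqP/eq0_normc ->.
by rewrite mulrA -rmorphM divff// rmorph1 mul1r.
Qed.

Lemma measurable_normc (R : realType) (u : R -> R[i]) :
  measurable_complex u -> measurable_fun [set: R] (fun x => normc (u x)).
Proof.
move=> [mr mi]; under eq_fun do rewrite normc_sqrtE.
apply: (measurableT_comp (continuous_measurable_fun (@sqrt_continuous R))).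
by apply: measurable_funD; exact: measurable_funX.
Qed.

Lemma measurable_complexM_real (R : realType) (r : R -> R) (u : R -> R[i]) :
  measurable_fun [set: R] r -> measurable_complex u ->
  measurable_complex (fun x => (r x)%:C * u x).
Proof.
move=> mr [mre mim].
have ReE x : complex.Re ((r x)%:C * u x) = r x * complex.Re (u x).
  by case: (u x) => ? ? /=; ring.
have ImE x : complex.Im ((r x)%:C * u x) = r x * complex.Im (u x).
  by case: (u x) => ? ? /=; ring.
by split; [under eq_fun do rewrite ReE|under eq_fun do rewrite ImE];
  exact: measurable_funM.
Qed.

(** The phase jumps at zero, so it is split by a measurable test on the modulus; writing the inverse
    modulus as a real power gives its measurability by composition. *)
Lemma measurable_unit_phase (R : realType) (u : R -> R[i]) :
  measurable_complex u -> measurable_complex (fun x => unit_phase (u x)).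
Proof.
move=> mu; have mn := measurable_normc _ _ mu.
have E x : unit_phase (u x) =
    if normc (u x) == 0 then 1 else (normc (u x) `^ (- 1))%:C * u x.
  rewrite /unit_phase; have -> : (normc (u x) == 0) = (u x == 0).
    by apply/eqP/eqP => [/eq0_normc//|->]; exact: normc0.
  by rewrite powR_inv1 ?normc_ge0.
have mb : measurable_fun [set: R] (fun x => normc (u x) == 0).
  by apply: measurable_fun_eqr => //; exact: measurable_cst.
have [m1 m2] : measurable_complex (fun x => (normc (u x) `^ (- 1))%:C * u x).
  apply: measurable_complexM_real => //.
  exact: (measurableT_comp (measurable_powR _)).
by split; under eq_fun do rewrite E ?(fun_if (@complex.Re R)) ?(fun_if (@complex.Im R));
  apply: measurable_fun_ifT.
Qed.

Lemma smoothC_continuous (R : realType) (V : normedModType R) (u : V -> R[i]) :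
  smoothC u -> continuous (fun x => complex.Re (u x)) /\
               continuous (fun x => complex.Im (u x)).
Proof. by move=> /(_ 0%N). Qed.

Lemma continuous_measurable_complex (R : realType) (u : R -> R[i]) :
  continuous (fun x => complex.Re (u x)) ->
  continuous (fun x => complex.Im (u x)) -> measurable_complex u.
Proof. by move=> cr ci; split; exact: continuous_measurable_fun. Qed.

Lemma continuous_sqr_normc (R : realType) (u : R -> R[i]) :
  continuous (fun x => complex.Re (u x)) ->
  continuous (fun x => complex.Im (u x)) -> continuous (fun x => normc (u x) ^+ 2).
Proof.
move=> cr ci; under eq_fun do rewrite sqr_normcE.
by move=> x; apply: cvgD; [exact: (cvgM (cr x) (cr x))|exact: (cvgM (ci x) (ci x))].
Qed.

Lemma LpnormC2E (R : realType) (u : R -> R[i]) :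
  (LpnormC 2%:E u `^ 2 = \int[lebesgue_measure]_x (normc (u x) ^+ 2)%:E)%E.
Proof.
rewrite /LpnormC poweR_Lnorm//; apply: eq_integral => x _.
by rewrite abse_EFin poweR_EFin powR_mulrn// ger0_norm ?normc_ge0.
Qed.

(** Both terms are real multiples of the same unit phase. *)
Lemma normc_sub_aligned (R : rcfType) (u : R[i]) (r : R) :
  normc (u - r%:C * unit_phase u) = `|normc u - r|.
Proof.
rewrite {1}(normc_mul_unit_phase _ u) -mulrBl -rmorphB normcM.
by rewrite normc_unit_phase normc_real mulr1.
Qed.

Lemma measurable_aligned_remainder (R : realType) (u v : R -> R[i]) :
  measurable_complex u -> measurable_complex v ->
  measurable_complex (fun x => u x - (normc (v x))%:C * unit_phase (u x)).
Proof.
move=> mu mv; under eq_fun => x do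
  rewrite {1}(normc_mul_unit_phase _ (u x)) -mulrBl -rmorphB.
apply: measurable_complexM_real; last exact: measurable_unit_phase.
by apply: measurable_funB; exact: measurable_normc.
Qed.

(** * Norm of the remainders and assembly *)

(** Serves both components: [u] is a time slice of the solution and [v] the datum translated along
    the characteristic. *)
Lemma aligned_remainder_bound (R : realType) (m T t K a b : R) (e0 : R -> R)
    (u v : R -> R[i]) (p : \bar R) :
  0 <= t <= T -> K = `|m| * (T + 1) + 1 -> 0 <= a -> 0 <= b ->
  measurable_complex u -> measurable_complex v ->
  continuous e0 -> (forall x, 0 <= e0 x) ->
  (\int[lebesgue_measure]_x (e0 x)%:E = (a ^+ 2 + b ^+ 2)%:E)%E ->
  (forall x, (normc (u x) - normc (v x)) ^+ 2 <=
     m ^+ 2 * t / 2 * \int[lebesgue_measure]_(y in `[x - t, x + t]) e0 y) ->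
  (2%:E <= p)%E ->
  (LpnormC p (fun x => u x - (normc (v x))%:C * unit_phase (u x))%R <=
    (K * (a + b))%:E)%E.
Proof.
move=> /andP[t0 tT] KE a0 b0 mu mv ce e00 Ie uv p2.
have m0 := normr_ge0 m.
(* K^2 dominates m^2 t / 2 for the sup bound and m^2 t^2 for the L^2 bound. *)
have K2 : `|m| ^+ 2 * (T + 1) ^+ 2 <= K ^+ 2.
  rewrite -exprMn KE ler_sqr ?nnegrE ?lerDl// ?addr_ge0// ?mulr_ge0//; lra.
have mm : m ^+ 2 = `|m| ^+ 2 by rewrite real_normK ?num_real.
have m20 : 0 <= `|m| ^+ 2 by rewrite sqr_ge0.
have tT2 : t * t <= T * T by rewrite ler_pM.
(* The window estimate yields the root of [a ^+ 2 + b ^+ 2], which is at most [a + b] for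
   nonnegative [a] and [b]. *)
apply: (@le_trans _ _ (K * Num.sqrt (a ^+ 2 + b ^+ 2))%:E); last first.
  rewrite lee_fin ler_wpM2l//; first by rewrite KE addr_ge0// mulr_ge0//; lra.
  rewrite -(@ler_pXn2r _ 2) ?nnegrE ?sqrtr_ge0 ?addr_ge0//.
  rewrite sqr_sqrtr ?addr_ge0 ?sqr_ge0//.
  by have := mulr_ge0 a0 b0; lra.
apply: (window_Lnorm_bound _ _ e0 _ t (m ^+ 2 * t / 2)) => //.
- by apply: measurable_normc; exact: measurable_aligned_remainder.
- by move=> x; exact: normc_ge0.
- by rewrite divr_ge0// mulr_ge0// sqr_ge0.
- by rewrite KE addr_ge0// mulr_ge0//; lra.
- apply: le_trans K2; rewrite mm -mulrA ler_wpM2l//; nra.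
- apply: le_trans K2.
  have -> : m ^+ 2 * t / 2 * (2 * t) = `|m| ^+ 2 * (t * t) by rewrite mm; field.
  rewrite ler_wpM2l//; nra.
- by move=> x; rewrite normc_sub_aligned real_normK ?num_real.
Qed.

Theorem proposition7 (R : realType) (m T : R) (T_gt0 : 0 < T) :
  exists2 C : R, 0 < C &
  forall (lambda : R) (p : \bar R) (f g : R -> R[i]) (psi phi : R * R -> R[i]),
    (2%:E <= p)%E ->
    smooth_compact_support f -> smooth_compact_support g ->
    smoothC psi -> smoothC phi ->
    thirring m lambda psi phi ->
    (forall x : R, psi (0, x) = f x) ->
    (forall x : R, phi (0, x) = g x) ->
    exists psiL phiL psiN phiN : R * R -> R[i],
      [/\ forall z : R * R, psi z = psiL z + psiN z,
          forall z : R * R, phi z = phiL z + phiN z,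
          forall t x : R, normc (psiL (t, x)) = normc (f (x - t)),
          forall t x : R, normc (phiL (t, x)) = normc (g (x + t)) &
          forall t : R, 0 <= t <= T ->
            [/\ measurable_complex (fun x => psiN (t, x)),
                measurable_complex (fun x => phiN (t, x)) &
                (LpnormC p (fun x => psiN (t, x)) +
                 LpnormC p (fun x => phiN (t, x)) <=
                 C%:E * (LpnormC 2%:E f + LpnormC 2%:E g))%E]].
Proof.
(* The final summand 1 keeps the constant positive when [m = 0]. *)
pose K := `|m| * (T + 1) + 1.
have K0 : 0 < K by rewrite ltr_wpDl// mulr_ge0//; lra.
(* Each of the two remainders contributes [K] times the sum of the L^2 norms of the data. *)
exists (2 * K) => [|lambda p f g psi phi p2 [sf _] [sg _] spsi sphi eqn psi0 phi0].
  by rewrite mulr_gt0.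
pose psiL (z : R * R) := (normc (f (z.2 - z.1)))%:C * unit_phase (psi z).
pose phiL (z : R * R) := (normc (g (z.2 + z.1)))%:C * unit_phase (phi z).
exists psiL, phiL, (fun z => psi z - psiL z), (fun z => phi z - phiL z).
have nL (r : R[i]) (u : R[i]) : normc ((normc r)%:C * unit_phase u) = normc r.
  by rewrite normcM normc_unit_phase mulr1 normc_real ger0_norm ?normc_ge0.
split=> [z|z|t x|t x|t t0T]; rewrite ?subrKC//; first exact: nL.
  exact: nL.
have slice u : smoothC u -> measurable_complex (fun x : R => u (t, x)).
  move=> /smoothC_continuous[cr ci].
  by apply: continuous_measurable_complex;
    [exact: (@continuous_slice2 _ _ t cr)|exact: (@continuous_slice2 _ _ t ci)].
have [cfr cfi] := smoothC_continuous _ _ _ sf.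
have [cgr cgi] := smoothC_continuous _ _ _ sg.
have shift (u : R -> R[i]) c : continuous (fun x => complex.Re (u x)) ->
    continuous (fun x => complex.Im (u x)) -> measurable_complex (fun x => u (x + c)).
  move=> cr ci; apply: continuous_measurable_complex => x.
    by apply: (@continuous_comp _ _ _ (fun x => x + c) (fun x => complex.Re (u x)));
      [apply: cvgD; [exact: cvg_id|exact: cvg_cst]|exact: cr].
  by apply: (@continuous_comp _ _ _ (fun x => x + c) (fun x => complex.Im (u x)));
    [apply: cvgD; [exact: cvg_id|exact: cvg_cst]|exact: ci].
pose e0 x := normc (f x) ^+ 2 + normc (g x) ^+ 2.
have ce0 : continuous e0.
  move=> x; apply: cvgD; [exact: (continuous_sqr_normc _ _ cfr cfi)|
    exact: (continuous_sqr_normc _ _ cgr cgi)].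
have e00 x : 0 <= e0 x by rewrite addr_ge0 ?sqr_ge0.
have Ie : (\int[lebesgue_measure]_x (e0 x)%:E =
    LpnormC 2%:E f `^ 2 + LpnormC 2%:E g `^ 2)%E.
  rewrite !LpnormC2E -ge0_integralD//.
  - by move=> x _; rewrite lee_fin sqr_ge0.
  - by apply/measurable_EFinP; apply: continuous_measurable_fun; exact: continuous_sqr_normc.
  - by move=> x _; rewrite lee_fin sqr_ge0.
  - by apply/measurable_EFinP; apply: continuous_measurable_fun; exact: continuous_sqr_normc.
have bounds x := thirring_characteristic_bounds _ _ _ _ _ t x spsi sphi eqn (proj1 (andP t0T)).
have BE x : \int[lebesgue_measure]_(y in `[x - t, x + t])
    (normc (psi (0, y)) ^+ 2 + normc (phi (0, y)) ^+ 2) =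
    \int[lebesgue_measure]_(y in `[x - t, x + t]) e0 y.
  by apply: eq_Rintegral => y _; rewrite psi0 phi0.
have mf : measurable_complex (fun x => f (x - t)) by exact: shift.
have mg : measurable_complex (fun x => g (x + t)) by exact: shift.
split; [exact: (measurable_aligned_remainder _ _ (fun x => f (x - t)) (slice _ spsi))
  |exact: (measurable_aligned_remainder _ _ (fun x => g (x + t)) (slice _ sphi))|].
have f0 : (0 <= LpnormC 2%:E f)%E by exact: Lnorm_ge0.
have g0 : (0 <= LpnormC 2%:E g)%E by exact: Lnorm_ge0.
have K20 : (0 < (2 * K)%:E)%E by rewrite lte_fin mulr_gt0.
(* An infinite L^2 norm of either datum makes the right-hand side infinite; the estimate then
   concerns real [a] and [b]. *)
case: (LpnormC 2%:E f) f0 Ie => [a| |]//; last first.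
  by move=> _ _; rewrite addye ?gt0_muley ?leey// -ltNye (lt_le_trans _ g0).
case: (LpnormC 2%:E g) g0 => [b| |]//; last first.
  by move=> _ _ _; rewrite addey// gt0_muley// leey.
rewrite !lee_fin => b0 a0 Ie; rewrite !poweR_EFin !powR_mulrn// -EFinD in Ie.
have -> : ((2 * K)%:E * (a%:E + b%:E) = (K * (a + b))%:E + (K * (a + b))%:E)%E.
  by rewrite -!EFinD -EFinM; congr EFin; ring.
apply: leeD.
- apply: (aligned_remainder_bound _ m T t K a b e0 _ (fun x => f (x - t))) => //.
    exact: slice.
  by move=> x; have := (bounds x).1; rewrite BE psi0.
- apply: (aligned_remainder_bound _ m T t K a b e0 _ (fun x => g (x + t))) => //.
    exact: slice.
  by move=> x; have := (bounds x).2; rewrite BE phi0.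
Qed.
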